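(* Let $\Theta=\mathbb{R}^n$, let $(\ell_t)_{t\ge 0}$ be smooth functions $\ell_t:\Theta\to\mathbb{R}$, let $(f(t))_{t\ge 0}$ be fixed nonzero real numbers, and let $\theta_0\in\Theta$ be fixed. For $\eta>0$ let $T_t(\eta)\in\Theta$ be the parameter obtained after $t$ iterations of the stochastic gradient recursion with step size $\eta$, and let $A_t(\eta)=\frac{\partial T_t(\eta)}{\partial\log\eta}$. Then $A_0(\eta)=0$ and, for all $t\ge 0$, $$A_{t+1}(\eta)=A_t(\eta)+\frac{\eta}{f(t)}\,\partial_\theta\ell_t(T_t(\eta))+\frac{\eta}{f(t)}\,\partial_\theta^2\ell_t(T_t(\eta))\cdot A_t(\eta).$$
   Context: $\partial_\theta\ell_t(\theta)\in\mathbb{R}^n$ is the Euclidean gradient of $\ell_t$ at $\theta$ and $\partial_\theta^2\ell_t(\theta)\cdot v$ is the Hessian of $\ell_t$ at $\theta$ applied to the vector $v\in\mathbb{R}^n$. The maps $T_t:(0,\infty)\to\Theta$ are defined by $T_0(\eta)=\theta_0$ for every $\eta$, and $$T_{t+1}(\eta)=T_t(\eta)+\frac{\eta}{f(t)}\,\partial_\theta\ell_t(T_t(\eta)),\qquad t\ge 0.$$ The derivative with respect to $\log\eta$ means the derivative after the substitution $\eta=e^u$: $\frac{\partial T_t(\eta)}{\partial\log\eta}=\frac{d}{du}T_t(e^u)\big|_{u=\log\eta}$. (The paper uses throughout the rate $f(t)=\sqrt{t+2}\,\log(t+3)$.) *)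

(* Defs.v *)
From mathcomp Require Import all_boot all_order all_algebra.
From mathcomp Require Import all_classical all_reals all_analysis.

Set Implicit Arguments.
Unset Strict Implicit.
Unset Printing Implicit Defensive.

Import Order.TTheory GRing.Theory Num.Theory.
Import numFieldNormedType.Exports.

Local Open Scope ring_scope.

(* Points of R^n are column vectors, so that the Hessian acts by [*m] on the
   left. *)

Definition partial (R : realType) (n : nat) (i : 'I_n) (g : 'cV[R]_n -> R) :
    'cV[R]_n -> R :=
  fun x => 'D_(delta_mx i 0) g x.

Definition iter_partial (R : realType) (n : nat) (s : seq 'I_n)
    (g : 'cV[R]_n -> R) : 'cV[R]_n -> R :=
  foldr (@partial R n) g s.

(* C^oo: the iterated partial derivatives of all orders exist and are
   continuous.  Since ['D_v] is a total operator, existence is required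
   separately. *)
Definition smooth (R : realType) (n : nat) (g : 'cV[R]_n -> R) : Prop :=
  forall s : seq 'I_n,
    continuous (iter_partial s g) /\
    forall (i : 'I_n) (x : 'cV[R]_n),
      derivable (iter_partial s g) x (delta_mx i 0).

Definition gradient (R : realType) (n : nat) (g : 'cV[R]_n -> R)
    (x : 'cV[R]_n) : 'cV[R]_n :=
  \col_i partial i g x.

(* Jacobian matrix of the gradient: entry (i, j) is the j-th partial derivative
   of the i-th component of the gradient. *)
Definition hessian (R : realType) (n : nat) (g : 'cV[R]_n -> R)
    (x : 'cV[R]_n) : 'M[R]_n :=
  \matrix_(i, j) partial j (fun y => gradient g y i 0) x.

(* [sgd l f theta0 t eta] is T_t(eta).  It is defined for every real [eta], but
   only the values at [0 < eta] are meaningful. *)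
Fixpoint sgd (R : realType) (n : nat) (l : nat -> 'cV[R]_n -> R)
    (f : nat -> R) (theta0 : 'cV[R]_n) (t : nat) (eta : R) : 'cV[R]_n :=
  if t is t'.+1 then
    let theta := sgd l f theta0 t' eta in
    theta + (eta / f t') *: gradient (l t') theta
  else theta0.

(* Derivative with respect to log eta, i.e. d/du F(e^u) at u = ln eta. *)
Definition log_derivable (R : realType) (n : nat) (F : R -> 'cV[R]_n)
    (eta : R) : Prop :=
  derivable (fun u : R => F (expR u)) (ln eta) 1.

Definition log_derive (R : realType) (n : nat) (F : R -> 'cV[R]_n)
    (eta : R) : 'cV[R]_n :=
  ((fun u : R => F (expR u))^`())%classic (ln eta).

(* Main.v *)
(* Differentiating the recursion needs the chain rule for the gradient of l_t
   along the curve u |-> T_t(e^u).  For a function h with continuous partial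
   derivatives, moving from x to y one coordinate at a time and applying the
   mean value theorem on each segment gives
   h y - h x = \sum_i (d_i h)(xi_i) (y_i - x_i) with |xi_i - x| <= |y - x|;
   dividing by the increment of the curve parameter and passing to the limit
   gives the chain rule, without going through Frechet differentiability. *)

Require Import Defs.
From mathcomp Require Import all_boot all_order all_algebra.
From mathcomp Require Import all_classical all_reals all_analysis.

Set Implicit Arguments.
Unset Strict Implicit.

Import Order.TTheory GRing.Theory Num.Theory.
Import numFieldNormedType.Exports.

Local Open Scope ring_scope.
Local Open Scope classical_set_scope.

(** Both sides are limits of the same difference quotient, since [(r + s) *: v + z] is
    [r *: v + (s *: v + z)]. *)
Lemma is_derive_line (R : realType) (V W : normedModType R) (h : V -> W)
    (z v : V) (s : R) :
  derivable h (s *: v + z) v ->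
  is_derive s (1 : R) (fun r : R => h (r *: v + z)) ('D_v h (s *: v + z)).
Proof.
move=> hd.
have E : (fun r : R => r^-1 *:
      (((fun r : R => h (r *: v + z)) \o shift s) (r *: 1) -
       h (s *: v + z))) =
    (fun r => r^-1 *: ((h \o shift (s *: v + z)) (r *: v) - h (s *: v + z))).
  by apply/funext => r /=; rewrite [r *: 1]mulr1 scalerDl addrA.
by apply: DeriveDef; rewrite /derivable /derive E.
Qed.

Lemma mvt_line (R : realType) (V : normedModType R) (h : V -> R)
    (z v : V) (a : R) :
  (forall x, derivable h x v) ->
  exists2 s : R, `|s| <= `|a| & h (a *: v + z) - h z = 'D_v h (s *: v + z) * a.
Proof.
move=> hd; set g := fun r : R => h (r *: v + z).
have gd r : is_derive r (1 : R) g ('D_v h (r *: v + z)).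
  exact: is_derive_line.
have gc (i : interval R) : {within [set` i], continuous g}.
  by apply: derivable_within_continuous => r _; apply: ex_derive.
have g0 : h z = g 0 by rewrite /g scale0r add0r.
(* An increment [a] may have either sign, so the mean value theorem is applied on [[0, a]] or on
   [[a, 0]]; in the second case both sides change sign. *)
have [a0|/ltW a0] := leP 0 a.
  have [s + E] := MVT_segment a0 (fun r _ => gd r) (gc _).
  rewrite in_itv /= => /andP[s0 sa].
  by exists s; rewrite ?ger0_norm// g0 E subr0.
have [s + E] := MVT_segment a0 (fun r _ => gd r) (gc _).
rewrite in_itv /= => /andP[sa s0].
exists s; first by rewrite !ler0_norm// lerN2.
by rewrite -[LHS]opprB g0 E sub0r mulrN opprK.
Qed.

Lemma cV_norm_le (R : realType) (n : nat) (x : 'cV[R]_n) (e : R) :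
  0 <= e -> (forall i, `|x i 0| <= e) -> `|x| <= e.
Proof.
move=> e0 xe; rewrite /Num.Def.normr/= mx_normrE.
rewrite (bigmax_le _ e0)//= => -[i j] _.
by rewrite ord1.
Qed.

Lemma cV_le_norm (R : realType) (n : nat) (x : 'cV[R]_n) i : `|x i 0| <= `|x|.
Proof.
by rewrite [leRHS]/Num.Def.normr/= mx_normrE; exact: (le_bigmax _ _ (i, 0)).
Qed.

Lemma mvt_partials (R : realType) (n : nat) (h : 'cV[R]_n -> R)
    (hd : forall i x, derivable h x (delta_mx i 0)) (x y : 'cV[R]_n) :
  exists2 xi : 'I_n -> 'cV[R]_n, (forall i, `|xi i - x| <= `|y - x|) &
    h y - h x = \sum_i partial i h (xi i) * (y i 0 - x i 0).
Proof.
(* The path from [x = z 0] to [y = z n] that replaces one coordinate at a time; the increments of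
   [h] along it telescope. *)
pose z k : 'cV[R]_n := \col_i (if (i < k)%N then y i 0 else x i 0).
have zS (k : 'I_n) : z k.+1 = (y k 0 - x k 0) *: delta_mx k 0 + z k.
  apply/colP => i; rewrite !mxE eqxx andbT ltnS leq_eqVlt -val_eqE /=.
  case: (ltngtP i k) => [ik|ki|/val_inj ->] /=; rewrite ?mulr0 ?add0r//.
  by rewrite mulr1 subrK.
pose P (k : 'I_n) (w : 'cV[R]_n) := `|w - x| <= `|y - x| /\
  h (z k.+1) - h (z k) = partial k h w * (y k 0 - x k 0).
have [xi xiP] : {xi & forall k, P k (xi k)}.
  apply: choice => k.
  have [s sle E] := mvt_line (z k) (y k 0 - x k 0) (hd k).
  exists (s *: delta_mx k 0 + z k); split; last by rewrite zS E.
  (* The norm is the sup norm. Coordinate [i] of the intermediate point minus [x] is [y i 0 - x i 0]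
     before [k], zero after [k], and [s] at [k]. *)
  apply: cV_norm_le => // i; rewrite !mxE eqxx andbT.
  case: (ltngtP i k) => [ik|ki|/val_inj ->] /=.
  - have -> : (i == k) = false by rewrite -val_eqE ltn_eqF.
    by rewrite mulr0 add0r; have := cV_le_norm (y - x) i; rewrite !mxE.
  - have -> : (i == k) = false by rewrite -val_eqE gtn_eqF.
    by rewrite mulr0 add0r subrr normr0.
  - rewrite eqxx mulr1 addrK (le_trans sle)//.
    by have := cV_le_norm (y - x) k; rewrite !mxE.
exists xi => [i|]; first by case: (xiP i).
have zn : z n = y by apply/colP => i; rewrite mxE ltn_ord.
have z0 : z 0%N = x by apply/colP => i; rewrite mxE.
rewrite -{1}zn -{1}z0 -(telescope_sumr (fun k => h (z k)))// big_mkord.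
by apply: eq_bigr => i _; case: (xiP i).
Qed.

(** Lets the scalar chain and product rules be used coordinate by coordinate on vector-valued
    curves. *)
Lemma is_derive_cVP (R : realType) (V : normedModType R) (n : nat)
    (M : V -> 'cV[R]_n) (t v : V) (dM : 'cV[R]_n) :
  is_derive t v M dM <->
  forall i, is_derive t v (fun x => M x i 0) (dM i 0).
Proof.
split=> [[Md <-] i|Md].
  apply: DeriveDef; first exact: (derivable_mxP M t v).1.
  by rewrite derive_mx// mxE.
have dM' : derivable M t v.
  by apply/derivable_mxP => i j; rewrite ord1; apply: ex_derive.
apply: DeriveDef => //; rewrite derive_mx//.
by apply/colP => i; rewrite mxE; apply: derive_val.
Qed.

Lemma is_derive_comp_partials (R : realType) (n : nat) (h : 'cV[R]_n -> R)
    (c : R -> 'cV[R]_n) (u : R) (dc : 'cV[R]_n) :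
  (forall i x, derivable h x (delta_mx i 0)) ->
  (forall i, {for c u, continuous (partial i h)}) ->
  is_derive u (1 : R) c dc ->
  is_derive u (1 : R) (h \o c) (\sum_i partial i h (c u) * dc i 0).
Proof.
move=> hd hc cd.
pose y (r : R) := c (r *: 1 + u).
(* Choice turns the intermediate points into functions of the increment [r], so that their limit as
   [r] tends to 0 makes sense. *)
have [xi xiP] : {xi : R -> 'I_n -> 'cV[R]_n & forall r,
    (forall i, `|xi r i - c u| <= `|y r - c u|) /\
    h (y r) - h (c u) = \sum_i partial i h (xi r i) * (y r i 0 - c u i 0)}.
  pose P r (w : 'I_n -> 'cV[R]_n) := (forall i, `|w i - c u| <= `|y r - c u|) /\
    h (y r) - h (c u) = \sum_i partial i h (w i) * (y r i 0 - c u i 0).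
  apply: (@choice _ _ P) => r.
  by have [w ? ?] := mvt_partials hd (c u) (y r); exists w.
have yc : y r @[r --> (0 : R)^'] --> c u.
  have cu : {for u, continuous c}.
    by apply/differentiable_continuous/derivable1_diffP/ex_derive.
  apply: (cvg_comp (fun r : R => r *: (1 : R) + u) c _ cu).
  apply: cvg_trans (_ : r *: (1 : R) + u @[r --> (0 : R)] --> u).
    exact/cvg_app/cvg_within.
  rewrite -[X in _ --> X]add0r -[X in _ --> X + u](scale0r (1 : R)).
  by apply: cvgD; [apply: cvgZ; [exact: cvg_id|exact: cvg_cst]|exact: cvg_cst].
(* Squeeze: [xi r i] is no farther from [c u] than [y r]. *)
have xic i : xi r i @[r --> (0 : R)^'] --> c u.
  apply/cvgrPdist_le => e e0; near=> r.
  rewrite distrC (le_trans ((xiP r).1 i))// distrC; near: r.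
  by move: e e0; apply/cvgrPdist_le.
suff L : (fun r : R => r^-1 *: (((h \o c) \o shift u) (r *: 1) - (h \o c) u))
    @ (0 : R)^' --> \sum_i partial i h (c u) * dc i 0.
  by apply: DeriveDef; [apply/cvg_ex; eexists; exact: L|exact/cvg_lim].
under eq_fun do rewrite /= (xiP _).2 scaler_sumr.
apply: cvg_big => [|i _]; first exact: add_continuous.
under eq_fun do rewrite scalerAr.
apply: cvgM; first exact: continuous_cvg (hc i) (xic i).
have [cid <-] := (is_derive_cVP c u 1 dc).1 cd i.
exact: cid.
Unshelve. all: by end_near. Qed.

Lemma is_derive_gradient_comp (R : realType) (n : nat) (g : 'cV[R]_n -> R)
    (c : R -> 'cV[R]_n) (u : R) (dc : 'cV[R]_n) :
  smooth g -> is_derive u (1 : R) c dc ->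
  is_derive u (1 : R) (gradient g \o c) (hessian g (c u) *m dc).
Proof.
move=> gs cd; apply/is_derive_cVP => i.
have gE : (fun y => gradient g y i 0) = partial i g.
  by apply/funext => y; rewrite mxE.
have -> : (fun x => (gradient g \o c) x i 0) = partial i g \o c.
  by rewrite -gE.
have -> : (hessian g (c u) *m dc) i 0 =
    \sum_j partial j (partial i g) (c u) * dc j 0.
  by rewrite mxE; apply: eq_bigr => j _; rewrite mxE gE.
(* Row [i] of the Hessian lists the derivatives [partial j (partial i g)], in the order of
   [iter_partial [:: j; i]], so symmetry of second derivatives does not enter. *)
apply: is_derive_comp_partials => // [j x|j].
  exact: (gs [:: i]).2.
exact: (gs [:: j; i]).1.
Qed.

(** Product rule: as [expR] is its own derivative, differentiating the step size returns the
    gradient term unchanged, and differentiating the gradient gives the Hessian term. *)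
Lemma is_derive_sgd_step (R : realType) (n : nat) (g : 'cV[R]_n -> R) (a : R)
    (c : R -> 'cV[R]_n) (u : R) (dc : 'cV[R]_n) :
  smooth g -> is_derive u (1 : R) c dc ->
  is_derive u (1 : R) (fun u => c u + (expR u / a) *: gradient g (c u))
    (dc + (expR u / a) *: gradient g (c u)
        + (expR u / a) *: (hessian g (c u) *m dc)).
Proof.
move=> gs cd.
have gd := is_derive_gradient_comp gs cd.
apply/is_derive_cVP => i.
have cid := (is_derive_cVP c u 1 dc).1 cd i.
have gid := (is_derive_cVP _ u 1 _).1 gd i.
have -> : (fun x => (c x + (expR x / a) *: gradient g (c x)) i 0) =
    (fun x => c x i 0) + a^-1 *: expR * (fun x => (gradient g \o c) x i 0).
  by apply/funext => x; rewrite mxE [X in _ + X]mxE [expR x / a]mulrC.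
have ed := is_deriveZ a^-1 (is_derive_expR u).
apply: (is_derive_eq (is_deriveD cid (is_deriveM ed gid))).
rewrite [RHS]mxE [X in _ = X + _]mxE [X in _ = _ + X + _]mxE.
rewrite [X in _ = _ + X]mxE -[RHS]addrA.
rewrite [X in _ = _ + X]addrC; congr (_ + (_ + _)).
  by rewrite [expR u / a]mulrC.
by rewrite [LHS]mulrC -[a^-1 *: expR u]/(a^-1 * expR u) [a^-1 * _]mulrC.
Qed.

Theorem lemma1 (R : realType) (n : nat) (l : nat -> 'cV[R]_n -> R)
    (f : nat -> R) (theta0 : 'cV[R]_n)
    (l_smooth : forall t : nat, smooth (l t))
    (f_neq0 : forall t : nat, f t != 0) :
  let T := sgd l f theta0 in
  let A := fun t : nat => log_derive (T t) in
  forall eta : R, 0 < eta ->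
    (forall t : nat, log_derivable (T t) eta) /\
    A 0%N eta = 0 /\
    forall t : nat,
      A t.+1 eta =
        A t eta
        + (eta / f t) *: gradient (l t) (T t eta)
        + (eta / f t) *: (hessian (l t) (T t eta) *m A t eta).
Proof.
move=> T A eta eta0.
(* One step yields both existence and value of the next derivative: existence feeds the induction on
   [t], the value is the claimed recursion. *)
have Tstep t : log_derivable (T t) eta ->
    is_derive (ln eta) (1 : R) (fun u => T t.+1 (expR u))
      (A t eta
        + (eta / f t) *: gradient (l t) (T t eta)
        + (eta / f t) *: (hessian (l t) (T t eta) *m A t eta)).
  move=> Td; rewrite /A /log_derive derive1E.
  have := is_derive_sgd_step (f t) (l_smooth t) (derivableP Td).
  (* Positivity of [eta] enters here, through [expR (ln eta) = eta]. *)
  by rewrite (lnK eta0).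
have Td t : log_derivable (T t) eta.
  elim: t => [|t /Tstep TS]; last exact: (@ex_derive _ _ _ _ _ _ _ TS).
  exact: derivable_cst.
split=> //; split=> [|t].
  by rewrite /A /log_derive derive1E derive_cst.
rewrite {1}/A /log_derive derive1E.
exact: (@derive_val _ _ _ _ _ _ _ (Tstep t (Td t))).
Qed.
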